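(* Let $\mathbb{P}$ denote random forcing. The following are equivalent: (1) $\mathsf{FA}_{\mathbb{P},\omega_1}$. (2) $\mathsf{ub}\text{-}\mathsf{FA}_{\mathbb{P},\omega_1}$. (3) $2^\omega$ is not the union of $\omega_1$ many null sets.
   Context: Random forcing is the set of Borel subsets of $2^\omega$ of positive Lebesgue measure, ordered by inclusion (strictly, the quotient identifying sets whose symmetric difference is null). Lebesgue measure $\mu$ on $2^\omega$ is the Borel measure with $\mu(N_t)=2^{-n}$ for $t\in 2^n$, where $N_t=\{x\in 2^\omega\mid t\subseteq x\}$. $\mathsf{FA}_{\mathbb{P},\omega_1}$: for any sequence $\langle D_\alpha\mid\alpha<\omega_1\rangle$ of dense subsets of $\mathbb{P}$ there is a filter $g\in V$ on $\mathbb{P}$ with $g\cap D_\alpha\ne\emptyset$ for all $\alpha<\omega_1$. $\mathsf{ub}\text{-}\mathsf{FA}_{\mathbb{P},\omega_1}$: for any such sequence there is a filter $g\in V$ on $\mathbb{P}$ with $g\cap D_\alpha\neq\emptyset$ for unboundedly many $\alpha<\omega_1$. Here $V$ is the universe (ground model). *)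

(* Defs.v *)
From HB Require Import structures.
From mathcomp Require Import all_boot all_order all_algebra.
From mathcomp Require Import generic_quotient wochoice.
From mathcomp Require Import all_classical all_reals all_analysis.
From mathcomp Require Import zify lra.

Set Implicit Arguments.
Unset Strict Implicit.
Unset Printing Implicit Defensive.

Import Order.TTheory GRing.Theory Num.Theory.
Import numFieldNormedType.Exports.

Local Open Scope classical_set_scope.
Local Open Scope ring_scope.

(* [W] is, up to isomorphism, the ordinal omega_1: an uncountable well-order
   all of whose proper initial segments are countable. *)
Definition is_omega1 (d : Order.disp_t) (W : orderType d) :=
  [/\ well_order (<=%O : rel W),
      forall a : W, countable [set b : W | (b < a)%O] &
      ~ countable [set: W]].

Lemma omega1_exists : exists (d : Order.disp_t) (W : orderType d), is_omega1 W.
Proof.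
have unc : ~ countable [set: set nat].
  move=> /countable_injP[f finj].
  pose D := [set n | exists2 A : set nat, f A = n & ~ A n].
  have nD : ~ D (f D).
    move=> DD; have [A fA nA] := DD; apply: nA.
    by have -> : A = D by apply: finj => //; rewrite inE.
  by apply: (nD); exists D.
have [r wor] := well_ordering_principle {classic set nat}.
have wor' : wo_chain r predT by move=> A _; exact: wor.
have rT x y : r x y || r y x by exact: (wo_chainW wor').
have rA : antisymmetric r by move=> x y; apply: (wo_chain_antisymmetric wor').
have rxx x : r x x by have := rT x x; rewrite orbb.
have rtr : transitive r.
  move=> y x z xy yz.
  have [//|nxz] := boolP (r x z).
  have zx : r z x by have := rT x z; rewrite (negbTE nxz).
  have [|m [[+ mlb] _]] := wor [pred w | (w == x) || (w == y) || (w == z)].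
    by exists x; rewrite inE eqxx.
  rewrite inE => /orP[/orP[]|] /eqP mE; subst m.
  - by rewrite -(negbTE nxz) mlb ?inE ?eqxx ?orbT.
  - have yx : r y x by apply: mlb; rewrite inE eqxx.
    by rewrite -(negbTE nxz) (rA x y) ?xy.
  - have zy : r z y by apply: mlb; rewrite inE eqxx ?orbT.
    by rewrite -(negbTE nxz) -(rA y z) ?yz.
have [P [Punc Pseg]] : exists P : pred {classic set nat}, ~ countable [set x | P x] /\
    forall a, P a -> countable [set b | [&& P b, r b a & b != a]].
  pose seg a := [set b | r b a && (b != a)].
  have [allc|] := pselect (forall a, countable (seg a)).
    exists predT; split => [c|a _]; last exact: allc.
    by apply: unc; apply: sub_countable c; apply: subset_card_le.
  move=> /existsNP[a0 na0].
  have [|m [[+ mlb] _]] := wor [pred a | `[< ~ countable (seg a) >]].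
    by exists a0; rewrite inE.
  rewrite inE => nm.
  exists (fun b => r b m && (b != m)); split => // a /andP[am nam].
  have [ca|na] := pselect (countable (seg a)).
    apply: sub_countable ca; apply: subset_card_le => b /= /and3P[_ ba nba].
    by rewrite /seg /= ba nba.
  have ma : r m a by apply: mlb; rewrite inE.
  by move: nam; rewrite (rA a m) ?eqxx // am ma.
pose W := {x : {classic set nat} | P x}.
pose le (x y : W) := r (val x) (val y).
pose lt (x y : W) := (y != x) && le x y.
have leA : antisymmetric le by move=> x y /rA /val_inj.
have leT : transitive le by move=> x y z; exact: rtr.
have let_ : total le by move=> x y; exact: rT.
pose wo := Order.isOrder.Build (Order.Disp tt tt) W
  (fun x y => erefl (lt x y)) (fun _ _ => erefl) (fun _ _ => erefl) leA leT let_.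
pose WO := HB.pack_for (orderType (Order.Disp tt tt)) W wo.
exists (Order.Disp tt tt), WO; split.
- apply: antisymmetric_well_order => // A [x Ax].
  have [|m [[+ mlb] _]] := wor [pred y | `[< exists2 w : W, w \in A & val w = y >]].
    by exists (val x); rewrite inE; exists x.
  rewrite inE => -[w Aw wm]; exists w; split => // y Ay.
  by rewrite /<=%O/= /le wm; apply: mlb; rewrite inE; exists y.
- move=> a.
  have := Pseg (val a) (valP a) => /countable_injP[f finj].
  apply/countable_injP; exists (f \o val) => x y.
  rewrite !inE /= => /andP[nax lx] /andP[nay ly] /finj exy.
  apply: val_inj; apply: exy; rewrite inE /=.
  + apply/and3P; split; [exact: valP|exact: lx|].
    by apply: contraNneq nax => /val_inj ->.
  + apply/and3P; split; [exact: valP|exact: ly|].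
    by apply: contraNneq nay => /val_inj ->.
- move=> /countable_injP[f finj]; apply: Punc; apply/countable_injP.
  pose g x := if insub x is Some u then f (u : W) else 0%N.
  exists g => x y; rewrite !inE /= => Px Py; rewrite /g !insubT /= => e.
  by have /(congr1 val) := finj _ _ (in_setT _) (in_setT _) e.
Qed.

Section ForcingAxioms.
Context {dP : Order.disp_t} (P : porderType dP).

Definition forcing_dense (D : set P) :=
  forall p : P, exists2 q, D q & (q <= p)%O.

Definition forcing_filter (g : set P) :=
  [/\ g !=set0,
      forall p q : P, g p -> (p <= q)%O -> g q &
      forall p q : P, g p -> g q -> exists r, [/\ g r, (r <= p)%O & (r <= q)%O]].

Context {dW : Order.disp_t} (W : orderType dW).

Definition FA :=
  forall D : W -> set P, (forall a, forcing_dense (D a)) ->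
  exists2 g, forcing_filter g & forall a, g `&` D a !=set0.

Definition ubFA :=
  forall D : W -> set P, (forall a, forcing_dense (D a)) ->
  exists2 g, forcing_filter g &
    forall b, exists2 a, (b < a)%O & g `&` D a !=set0.

End ForcingAxioms.

Fact random_display : Order.disp_t. Proof. exact: Order.Disp tt tt. Qed.

Section RandomForcing.
Context {d : measure_display} {T : measurableType d} {R : realType}.
Variable mu : {measure set T -> \bar R}.

Record random_cond := RandomCond {
  cond_set :> set T;
  cond_measurable : measurable cond_set;
  cond_gt0 : (0 < mu cond_set)%E }.

HB.instance Definition _ := gen_eqMixin random_cond.
HB.instance Definition _ := gen_choiceMixin random_cond.

Implicit Types A B C : random_cond.

Definition null_eq A B : bool := `[< mu (A `+` B) = 0%E >].

Lemma null_eqP A B :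
  null_eq A B <-> mu (A `\` B) = 0%E /\ mu (B `\` A) = 0%E.
Proof.
have mD (X Y : random_cond) : measurable (X `\` Y).
  exact: (measurableD (cond_measurable X) (cond_measurable Y)).
split=> [/asboolP AB|[AB BA]].
  have nAB : mu.-negligible (A `+` B).
    by apply/negligibleP => //; apply: measurableU; exact: mD.
  split; apply: measure_negligible => //; apply: negligibleS nAB => x.
    by left.
  by right.
apply/asboolP; apply: measure_negligible; first by apply: measurableU; exact: mD.
by apply: negligibleU; apply/negligibleP.
Qed.

Lemma nullD_trans A B C : mu (A `\` B) = 0%E ->
  mu (B `\` C) = 0%E -> mu (A `\` C) = 0%E.
Proof.
have mD (X Y : random_cond) : measurable (X `\` Y).
  exact: (measurableD (cond_measurable X) (cond_measurable Y)).
move=> AB BC; apply: measure_negligible => //.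
apply: (@negligibleS _ _ _ mu ((A `\` B) `|` (B `\` C))).
  move=> x [Ax nCx]; have [Bx|nBx] := pselect (cond_set B x); by [right|left].
by apply: negligibleU; apply/negligibleP.
Qed.

Lemma null_eq_refl : reflexive null_eq.
Proof. by move=> A; apply/null_eqP; rewrite setDv measure0. Qed.

Lemma null_eq_sym : symmetric null_eq.
Proof. by move=> A B; apply/idP/idP => /null_eqP[? ?]; apply/null_eqP. Qed.

Lemma null_eq_trans : transitive null_eq.
Proof.
move=> B A C /null_eqP[AB BA] /null_eqP[BC CB]; apply/null_eqP; split.
- exact: nullD_trans AB BC.
- exact: nullD_trans CB BA.
Qed.

Canonical null_eq_equiv :=
  EquivRel null_eq null_eq_refl null_eq_sym null_eq_trans.

Definition random_forcing := {eq_quot null_eq}%qT.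

HB.instance Definition _ := Choice.on random_forcing.
HB.instance Definition _ := EqQuotient.on random_forcing.

Local Open Scope quotient_scope.

Implicit Types p q r : random_forcing.

(* The order induced on the quotient by inclusion of representatives;
   [random_leP] below shows that it is inclusion modulo null sets. *)
Definition random_le p q : bool :=
  `[< exists A B, [/\ \pi_random_forcing A = p, \pi_random_forcing B = q &
                      A `<=` B] >].

Lemma piP A B : \pi_random_forcing A = \pi_random_forcing B <->
  mu (A `\` B) = 0%E /\ mu (B `\` A) = 0%E.
Proof. by rewrite -null_eqP; split => [/eqmodP|?]; last apply/eqmodP. Qed.

Lemma random_leP A B : random_le (\pi A) (\pi B) <-> mu (A `\` B) = 0%E.
Proof.
split=> [/asboolP[A' [B' [/piP[_ AA'] /piP[B'B _] A'B']]]|AB].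
  apply: (@nullD_trans _ A') => //; apply: (@nullD_trans _ B') => //.
  by have -> : A' `\` B' = set0 by rewrite setD_eq0.
have mI : measurable (A `&` B).
  exact: (measurableI _ _ (cond_measurable A) (cond_measurable B)).
have EI : mu A = mu (A `&` B).
  rewrite -[in LHS](setUIDK A B) measureU//.
  - by rewrite [X in (_ + X)%E]AB adde0.
  - exact: (measurableD (cond_measurable A) (cond_measurable B)).
  - by apply/seteqP; split => // x [[_ Bx] [_ nBx]].
have pI : (0 < mu (A `&` B))%E by rewrite -EI; exact: cond_gt0.
pose I : random_cond := RandomCond mI pI.
apply/asboolP; exists I, B; split => //; last by move=> x [].
apply/piP; split.
- have -> : I `\` A = set0; last exact: measure0.
  by apply/seteqP; split => // x [[Ax _]].
- have -> : A `\` I = A `\` B; last by [].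
  apply/seteqP; split => x [Ax nx]; split => //.
    by move=> Bx; apply: nx.
  by case=> _ Bx; apply: nx.
Qed.

Lemma random_le_refl : reflexive random_le.
Proof.
by elim/quotW => A; apply/random_leP; rewrite setDv measure0.
Qed.

Lemma random_le_anti : antisymmetric random_le.
Proof.
elim/quotW => A; elim/quotW => B /andP[/random_leP ? /random_leP ?].
exact/piP.
Qed.

Lemma random_le_trans : transitive random_le.
Proof.
elim/quotW => B; elim/quotW => A; elim/quotW => C.
by move=> /random_leP AB /random_leP BC; apply/random_leP; exact: nullD_trans BC.
Qed.

HB.instance Definition _ := Order.Le_isPOrder.Build random_display
  random_forcing random_le_refl random_le_anti random_le_trans.

End RandomForcing.

Notation borel_cantor := (g_sigma_algebraType (@open cantor_space)).

(* N_t: [t] is an initial segment of [x]. *)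
Definition cyl (t : seq bool) : set borel_cantor :=
  [set x | mkseq x (size t) = t].

Definition is_cantor_lebesgue (R : realType)
    (mu : {measure set borel_cantor -> \bar R}) :=
  forall t : seq bool, mu (cyl t) = ((2%:R^-1) ^+ size t)%:E.

Lemma open_cyl (U : set cantor_space) (x : cantor_space) :
  open U -> U x -> exists n, cyl (mkseq x n) `<=` U.
Proof.
move=> oU Ux.
pose F := filter_from [set: nat] (fun n => cyl (mkseq x n)).
have cylP n (y : cantor_space) :
    cyl (mkseq x n) y <-> forall i, (i < n)%N -> y i = x i.
  rewrite /cyl /= size_mkseq; split.
    by move=> e i ni; rewrite -(nth_mkseq false y ni) e nth_mkseq.
  move=> e; apply: (@eq_from_nth _ false); rewrite ?size_mkseq// => i ni.
  by rewrite !nth_mkseq ?e.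
have FF : Filter F.
  apply: filter_from_filter; first by exists 0%N.
  move=> i j _ _; exists (maxn i j) => // y /cylP yx; split; apply/cylP => k kl;
    apply: yx; rewrite leq_max kl ?orbT//.
have Fx : F --> x.
  apply/cvg_sup => N A [V] [[W] oW <-] WxN WA.
  exists N.+1 => // y /cylP yx; apply: WA; rewrite /= yx//.
have : F U by apply: Fx; apply: open_nbhs_nbhs.
by case=> n _ nU; exists n.
Qed.

Lemma open_cantorE (U : set cantor_space) : open U ->
  U = \bigcup_(t in [set t | cyl t `<=` U]) cyl t.
Proof.
move=> oU; apply/seteqP; split=> [x Ux|x [t tU]]; last exact: tU.
have [n nU] := open_cyl oU Ux.
by exists (mkseq x n) => //; rewrite /cyl /= size_mkseq.
Qed.

Section BinaryDigits.
Variable R : realType.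

Definition digits (x : R) : borel_cantor :=
  fun n => odd (Num.truncn (2 ^+ n.+1 * x)).

Let val2 (t : seq bool) := foldl (fun a (b : bool) => (a.*2 + b)%N) 0%N t.

Let val2_lt t : (val2 t < 2 ^ size t)%N.
Proof.
elim/last_ind: t => // t b IH; rewrite /val2 foldl_rcons size_rcons expnS.
by rewrite -/(val2 t); case: b; lia.
Qed.

Let trunc_half (y : R) : 0 <= y -> (Num.truncn (2 * y))./2 = Num.truncn y.
Proof.
move=> y0; have y20 : 0 <= 2 * y by rewrite mulr_ge0.
have /andP[] := Num.Theory.truncn_itv y20.
set k := Num.truncn (2 * y) => h1 h2; apply/esym/Num.Theory.truncn_def.
have e := odd_double_half k; have o1 : (odd k <= 1)%N by case: odd.
have l1 : (k./2.*2 <= k)%N by lia.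
have l2 : (k.+1 <= (k./2.+1).*2)%N by lia.
move: l1 l2; rewrite -!(ler_nat R) -!muln2 !natrM => l1 l2.
by apply/andP; split; lra.
Qed.

Let cyl_digits (x : R) t : 0 <= x < 1 ->
  (cyl t (digits x) <-> Num.truncn (2 ^+ size t * x) = val2 t).
Proof.
move=> /andP[x0 x1]; rewrite /cyl /=.
elim/last_ind: t => [|t b IH].
  rewrite expr0 mul1r; split => // _; apply: Num.Theory.truncn_def.
  by rewrite x0.
rewrite size_rcons mkseqS /val2 foldl_rcons -/(val2 t).
have p0 : 0 <= 2 ^+ size t * x by rewrite mulr_ge0// exprn_ge0.
have := trunc_half p0; rewrite mulrA -exprS => H.
have E := odd_double_half (Num.truncn (2 ^+ (size t).+1 * x)).
split.
  move=> /rcons_inj[/IH tt bb].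
  by rewrite -E H tt -/(digits x _) bb addnC.
move=> e; congr rcons.
  by apply/IH; rewrite -H e addnC half_bit_double.
by rewrite /digits e oddD odd_double; case: (b) => /=.
Qed.

Let digits_cylE t : (`[0, 1[ `&` digits @^-1` cyl t)%classic =
  [set` `[(val2 t)%:R / 2 ^+ size t, (val2 t).+1%:R / 2 ^+ size t[ ].
Proof.
have p0 : 0 < 2 ^+ size t :> R by rewrite exprn_gt0.
apply/seteqP; split => x /=; rewrite !in_itv/=.
  move=> [x01 /(cyl_digits _ x01) e].
  have /andP[x0 _] := x01.
  have := Num.Theory.truncn_itv (mulr_ge0 (ltW p0) x0); rewrite e => /andP[h1 h2].
  by rewrite ler_pdivrMr// ltr_pdivlMr// mulrC h1.
rewrite ler_pdivrMr// ltr_pdivlMr// mulrC => /andP[h1 h2].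
have x0 : 0 <= x by rewrite -(pmulr_rge0 _ p0); apply: le_trans h1.
have x1 : x < 1.
  rewrite -(ltr_pM2l p0) mulr1; apply: lt_le_trans h2 _.
  by rewrite -natrX ler_nat val2_lt.
have x01 : 0 <= x < 1 by rewrite x0.
split => //; apply/cyl_digits => //.
by apply: Num.Theory.truncn_def; rewrite h1.
Qed.

Lemma measurable_digits : measurable_fun (`[0, 1[ : set R) digits.
Proof.
apply: (@measurability _ _ _ borel_cantor _ _ (@open cantor_space)) => //.
move=> _ [U oU <-].
rewrite (open_cantorE oU) preimage_bigcup setI_bigcupr bigcup_mkcond.
apply: countable_bigcupT_measurable => [|t]; first exact: countableP.
by case: ifP => // _; rewrite digits_cylE; exact: measurable_itv.
Qed.

(* The image of Lebesgue measure on the unit interval under binary expansion. *)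
Lemma cantor_lebesgue_exists :
  exists mu : {measure set borel_cantor -> \bar R}, is_cantor_lebesgue mu.
Proof.
pose D : set R := [set` `[0, 1[ ].
have mD : measurable D by exact: measurable_itv.
have mf : measurable_fun [set: R] (digits \_ D).
  by apply/(measurable_restrictT _ mD); exact: measurable_digits.
pose m := @measure_function_pushforward__canonical__measure_function_Measure
  _ _ _ _ R (mrestr lebesgue_measure mD) _ mf.
exists m => t.
rewrite /= /pushforward /mrestr.
have -> : (digits \_ D) @^-1` cyl t `&` D = D `&` digits @^-1` cyl t.
  apply/seteqP; split => x /= [].
    by rewrite /patch => + Dx; rewrite mem_set.
  by move=> Dx h; rewrite /patch mem_set.
rewrite digits_cylE lebesgue_measure_itv /=.
have p0 : 0 < 2 ^+ size t :> R by rewrite exprn_gt0.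
rewrite lte_fin ltr_pM2r ?invr_gt0// ltr_nat ltnSn -EFinB -mulrBl -natrB// subSnn.
by rewrite mul1r exprVn.
Qed.

End BinaryDigits.

(* Main.v *)
Require Import Defs.
From mathcomp Require Import all_boot all_order all_algebra.
From mathcomp Require Import all_classical all_reals all_analysis.

Set Implicit Arguments.
Unset Strict Implicit.
Unset Printing Implicit Defensive.

Import Order.TTheory GRing.Theory Num.Theory.

Local Open Scope classical_set_scope.
Local Open Scope ring_scope.

(** The forcing axiom implies its unbounded form because omega_1 has no last
    element. The other two implications use that initial segments of omega_1
    are countable, so that what is collected up to a stage stays null.

    From the unbounded axiom to the non-covering statement: suppose that the null
    sets [N a] cover the space, and let [N_le a] be the union of the [N b] with
    [b <= a], again a null set. Borel probability measures on Cantor space are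
    inner regular ([closed_approx]), hence below every condition there is a
    closed one disjoint from [N_le a] ([cond_closed_avoiding]), and the conditions with
    such a representative are dense. Members of a filter have intersections of
    positive measure, so by compactness all closed representatives in the
    filter have a common point ([filter_closed_point]). That point avoids
    [N_le a] for unboundedly many [a], hence avoids every [N a].

    From the non-covering statement to the forcing axiom: by exhaustion, each dense
    set [D a] contains the classes of a countable set [S a] of Borel sets whose
    union is conull ([dense_countable_cover]). A point [x] should decide the
    filter, generated by those members of the [S a] that contain [x]; the
    danger is that finitely many of them contain [x] and still have null
    intersection. But for each [a] only countably many finite families can be
    formed from the [S b] with [b <= a], so their null intersections, together
    with the complement of the union of [S a], form a null set. A point [x]
    outside all these null sets lies on an element of every [S a], and the
    elements through [x] have finite intersections of positive measure, hence
    generate a filter ([filter_of_meets]). *)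

(** * Countable sets and countable unions *)

(** Turns unions over countable index sets into unions over the natural
    numbers, the form in which sigma-additivity is available. *)
Lemma countable_enum {I : Type} (S : set I) : countable S -> S !=set0 ->
  exists2 f : nat -> I, forall n, S (f n) & forall i, S i -> exists n, f n = i.
Proof.
move=> /countable_injP[c cinj] [i0 Si0].
have /choice[f fP] n :
    exists i, S i /\ forall j, S j -> c j = n -> j = i.
  have [[i Si cn]|nS] := pselect (exists2 i, S i & c i = n).
    by exists i; split=> // j Sj cj; apply: cinj; rewrite ?inE// cj.
  by exists i0; split=> // j Sj cj; case: nS; exists j.
exists f => [n|i Si]; first by case: (fP n).
by exists (c i); case: (fP (c i)) => _ /(_ i Si erefl).
Qed.

Lemma countable_setU1 {I : Type} (S : set I) (i : I) :
  countable S -> countable (S `|` [set i]).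
Proof.
move=> cS; have -> : S `|` [set i] = \bigcup_b (if b then S else [set i]).
  apply/seteqP; split=> j; first by case=> [Sj|ij]; [exists true|exists false].
  by case=> -[] _; [left|right].
by apply: bigcup_countable => // -[] _ //; exact: countable1.
Qed.

Lemma countable_seq {I : eqType} (S : set I) : countable S ->
  countable [set s : seq I | forall i, i \in s -> S i].
Proof.
move=> /countable_injP[c cinj]; apply/countable_injP.
exists (fun s => pickle (map c s)) => s t; rewrite !inE /= => Ss St.
move=> /(pcan_inj pickleK); apply: (inj_in_map cinj).
- by apply/allP => i /Ss Si; exact: mem_set.
- by apply/allP => i /St Si; exact: mem_set.
Qed.

Section CountableUnions.
Context {dT : measure_display} {T : measurableType dT} {R : realType}.

Lemma bigcup_measurable_countable {I : Type} (S : set I) (F : I -> set T) :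
  countable S -> (forall i, S i -> measurable (F i)) ->
  measurable (\bigcup_(i in S) F i).
Proof.
move=> cS mF; have [->|/set0P S0] := eqVneq S set0.
  by rewrite bigcup_set0; exact: measurable0.
have [f fS Sf] := countable_enum cS S0.
suff -> : \bigcup_(i in S) F i = \bigcup_n F (f n).
  by apply: bigcup_measurable => n _; exact: mF.
apply/seteqP; split=> [x [i Si Fx]|x [n _ Fx]]; last by exists (f n).
by have [n fn] := Sf i Si; exists n; rewrite ?fn.
Qed.

Lemma negligible_bigcup_countable (mu : {measure set T -> \bar R})
    {I : Type} (S : set I) (F : I -> set T) :
  countable S -> (forall i, S i -> mu.-negligible (F i)) ->
  mu.-negligible (\bigcup_(i in S) F i).
Proof.
move=> cS nF; have [->|/set0P S0] := eqVneq S set0.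
  by rewrite bigcup_set0; exact: negligible_set0.
have [f fS Sf] := countable_enum cS S0.
apply: (@negligibleS _ _ _ _ (\bigcup_n F (f n))); last first.
  by apply: negligible_bigcup => n; exact: nF.
by move=> x [i Si Fx]; have [n fn] := Sf i Si; exists n; rewrite ?fn.
Qed.

End CountableUnions.

(** * Approximation by closed sets from inside *)

Lemma borel_closed (T : ptopologicalType) (C : set T) :
  closed C -> measurable (C : set (g_sigma_algebraType (@open T))).
Proof.
move=> cC; rewrite -(setCK C); apply: measurableC; apply: sub_sigma_algebra.
exact: closed_openC.
Qed.

Section ClosedApproximation.
Context {R : realType} {T : ptopologicalType}.
Variable mu : {measure set (g_sigma_algebraType (@open T)) -> \bar R}.
Hypothesis mu_fin : (mu setT < +oo)%E.

(** A countable union of closed sets need not be closed; by continuity of a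
    finite measure along decreasing sequences, a finite part of the union does
    as well up to a small measure. *)
Lemma closed_tail (E : nat -> set T) (G : set T) (e : R) :
  (forall n, closed (E n)) -> closed G ->
  (mu (~` (\bigcup_n E n `|` G)) < e%:E)%E ->
  exists n, (mu (~` (\bigcup_(i < n) E i `|` G)) < e%:E)%E.
Proof.
move=> cE cG lt_e; apply: contrapT => /forallNP ge_e.
have cU n : closed (\bigcup_(i < n) E i `|` G).
  by apply: closedU => //; apply: closed_bigcup => // i _; exact: cE.
pose H n : set (g_sigma_algebraType (@open T)) :=
  ~` (\bigcup_(i < n) E i `|` G).
have mH n : measurable (H n) by apply: measurableC; exact: borel_closed.
have HE : \bigcap_n H n = ~` (\bigcup_n E n `|` G).
  apply/seteqP; split=> x.
    move=> Hx [[n _ Ex]|Gx]; last by apply: (Hx 0%N) => //; right.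
    by apply: (Hx n.+1) => //; left; exists n => /=.
  by move=> nx n _ [[i _ Ex]|Gx]; apply: nx; [left; exists i|right].
have Hcvg : (mu \o H) x @[x --> \oo] --> mu (\bigcap_n H n).
  apply: nonincreasing_cvg_mu => //.
  - by apply: le_lt_trans mu_fin; apply: le_measure; rewrite ?inE.
  - by apply: bigcap_measurable => //; exists 0%N.
  - move=> m n mn; apply/subsetPset => x nx [[i /= im Ex]|Gx]; apply: nx.
      by left; exists i => //=; exact: leq_trans mn.
    by right.
have : (e%:E <= mu (\bigcap_n H n))%E.
  rewrite -(cvg_lim (@ereal_hausdorff _) Hcvg).
  apply: lime_ge; first by apply/cvg_ex; eexists; exact: Hcvg.
  by apply: nearW => n /=; rewrite leNgt; apply/negP; exact: ge_e.
by rewrite HE leNgt lt_e.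
Qed.

(** The class of sets trapped between a closed set and the complement of a
    closed set, up to small measure, is a sigma-algebra. Keeping a closed set
    on both sides makes it stable under complement for free. It contains the
    open sets as soon as these are F_sigma. *)
Lemma closed_approx :
  (forall U : set T, open U ->
    exists2 F : nat -> set T, forall n, closed (F n) & U = \bigcup_n F n) ->
  forall A : set (g_sigma_algebraType (@open T)), measurable A ->
  forall e : R, 0 < e ->
  exists F G : set T, [/\ closed F, closed G, F `<=` A, G `<=` ~` A &
    (mu (~` (F `|` G)) < e%:E)%E].
Proof.
move=> Fsigma.
pose reg (A : set T) := forall e : R, 0 < e ->
  exists F G : set T, [/\ closed F, closed G, F `<=` A, G `<=` ~` A &
    (mu (~` (F `|` G)) < e%:E)%E].
move=> A mA; suff : reg A by [].
move: A mA; apply: smallest_sub; last first.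
  move=> U oU e e0; have [E cE UE] := Fsigma U oU.
  have [||n En] := @closed_tail E (~` U) e cE.
  - exact: open_closedC.
  - by rewrite -UE setUv setCT measure0 lte_fin.
  exists (\bigcup_(i < n) E i), (~` U); split=> //.
  - by apply: closed_bigcup => // i _; exact: cE.
  - exact: open_closedC.
  - by rewrite UE => x [i _ Ex]; exists i.
split.
- move=> e e0; exists set0, setT; split=> //.
  + exact: closed0.
  + by rewrite setC0.
  + by rewrite setUT setCT measure0 lte_fin.
- move=> A rA e e0; have [F [G [cF cG FA GA FG]]] := rA e e0.
  exists G, F; split=> //.
  + by move=> x /GA.
  + by move=> x Fx [_]; apply; exact: FA.
  + by rewrite setUC.
- move=> A rA e e0.
  (* The n-th error is at most (e/2)/2^(n+1); the sum e/2 leaves room for the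
     strict inequality. *)
  have d0 n : 0 < e / 2 / (2 ^ n.+1)%:R.
    by rewrite divr_gt0// ?divr_gt0// ltr0n expn_gt0.
  have /choice[FG FGP] n : exists FG : set T * set T,
    [/\ closed FG.1, closed FG.2, FG.1 `<=` A n, FG.2 `<=` ~` A n &
    (mu (~` (FG.1 `|` FG.2)) < (e / 2 / (2 ^ n.+1)%:R)%:E)%E].
    by have [F [G FGn]] := rA n _ (d0 n); exists (F, G).
  pose F n := (FG n).1; pose G n := (FG n).2.
  have cF n : closed (F n) by case: (FGP n).
  have cG n : closed (G n) by case: (FGP n).
  have FA n : F n `<=` A n by case: (FGP n).
  have GA n : G n `<=` ~` A n by case: (FGP n).
  pose H n : set (g_sigma_algebraType (@open T)) := ~` (F n `|` G n).
  have mH n : measurable (H n).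
    by apply: measurableC; apply: borel_closed; exact: closedU.
  have cGI : closed (\bigcap_n G n) by apply: closed_bigI => n _; exact: cG.
  have mFGI : measurable
      (~` (\bigcup_n F n `|` \bigcap_n G n) : set (g_sigma_algebraType (@open T))).
    apply: measurableC; apply: measurableU; last exact: borel_closed.
    by apply: bigcup_measurable => n _; exact: borel_closed.
  have [|//|n Fn] := @closed_tail F (\bigcap_n G n) e cF.
  + exact: cGI.
  + apply: (@le_lt_trans _ _ (e / 2)%:E); last first.
      by rewrite lte_fin ltr_pdivrMr// ltr_pMr// ltr1n.
    apply: (@le_trans _ _ (mu (\bigcup_n H n))).
      apply: le_measure; rewrite ?inE//; first exact: bigcup_measurable.
      move=> x nx; apply: contrapT => nH; apply: nx.
      have [[n Fx]|nF] := pselect (exists n, F n x); first by left; exists n.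
      right=> n _; apply: contrapT => nG; apply: nH.
      by exists n => // -[] // Fx; apply: nF; exists n.
    apply: (le_trans (le_mu_bigcup mu mH _)); first exact: bigcup_measurable.
    apply: (le_trans _ (@epsilon_trick0 R (e / 2) xpredT _)); last first.
      by rewrite divr_ge0// ltW.
    by apply: lee_nneseries => // n _; case: (FGP n) => _ _ _ _ /ltW.
  + exists (\bigcup_(i < n) F i), (\bigcap_n G n); split=> //.
    * by apply: closed_bigcup => // i _; exact: cF.
    * by move=> x [i _ Fx]; exists i => //; exact: FA.
    * by move=> x Gx [i _ Ax]; apply: GA (Ax); exact: Gx.
Qed.

End ClosedApproximation.

(** * Conditions and filters of random forcing *)

Local Open Scope quotient_scope.

Section RandomForcingTheory.
Context {dT : measure_display} {T : measurableType dT} {R : realType}.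
Variable mu : {measure set T -> \bar R}.
Hypothesis mu_fin : (mu setT < +oo)%E.
Local Notation cond := (random_cond mu).
Local Notation forcing := (random_forcing mu).

Lemma pi_le_subset (A B : cond) :
  cond_set A `<=` cond_set B -> (\pi_(forcing) A <= \pi_(forcing) B)%O.
Proof.
move=> AB; apply/random_leP.
by have -> : cond_set A `\` cond_set B = set0; [rewrite setD_eq0|exact: measure0].
Qed.

(** Exhaustion: among countable unions of representatives of members of [D],
    one has maximal measure, since suprema of measures are approached by
    sequences. If its complement had positive measure, density would give a
    member of [D] below it, and adding that member would increase the
    measure. *)
Lemma dense_countable_cover (D : set forcing) : forcing_dense D ->
  exists S : set cond, [/\ countable S,
    forall A : cond, S A -> D (\pi_(forcing) A) &
    mu.-negligible (~` \bigcup_(A in S) cond_set A)].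
Proof.
move=> dD.
pose U (S : set cond) := \bigcup_(A in S) cond_set A.
pose small (S : set cond) :=
  countable S /\ forall A : cond, S A -> D (\pi_(forcing) A).
have mU S : small S -> measurable (U S).
  move=> [cS _]; apply: bigcup_measurable_countable => // A _.
  exact: cond_measurable.
have V0 : [set mu (U S) | S in small] != set0.
  apply/set0P; exists (mu (U set0)); exists set0 => //; split=> //.
have [u uV ucvg] := ereal_sup_seq V0.
have /choice[S SP] i : exists S, small S /\ mu (U S) = u i.
  by have [S sS <-] := uV i; exists S.
pose S0 := \bigcup_i S i.
have sS0 : small S0.
  split; first by apply: bigcup_countable => // i _; case: (SP i) => -[].
  by move=> A [i _ SA]; case: (SP i) => -[_ +] _; exact.
have maxS0 S' : small S' -> (mu (U S') <= mu (U S0))%E.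
  move=> sS'; apply: (@le_trans _ _ (ereal_sup [set mu (U S) | S in small])).
    by apply: ereal_sup_ubound; exists S'.
  rewrite -(cvg_lim (@ereal_hausdorff _) ucvg); apply: lime_le.
    by apply/cvg_ex; eexists; exact: ucvg.
  apply: nearW => i; case: (SP i) => sSi <-.
  apply: le_measure; rewrite ?inE; [exact: mU|exact: mU|].
  by move=> x [A SA Ax]; exists A => //; exists i.
exists S0; split; [exact: sS0.1|exact: sS0.2|].
have mC : measurable (~` U S0) by apply: measurableC; exact: mU.
apply/negligibleP => //; apply/eqP; rewrite eq_le measure_ge0 andbT leNgt.
apply/negP => C0; pose C : cond := RandomCond mC C0.
have [q Dq] := dD (\pi_(forcing) C).
elim/quotW: q Dq => Q DQ /random_leP QC.
have sS' : small (S0 `|` [set Q]).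
  split=> [|A [/sS0.2//|->//]].
  exact: countable_setU1 sS0.1.
have mQ := cond_measurable Q.
have mQI : measurable (cond_set Q `&` ~` U S0) by exact: measurableI.
have := maxS0 _ sS'; rewrite leNgt => /negP; apply.
have -> : U (S0 `|` [set Q]) = U S0 `|` (cond_set Q `&` ~` U S0).
  rewrite /U bigcup_setU bigcup_set1; apply/seteqP; split=> x.
    case=> [|Qx]; first by left.
    by have [?|?] := pselect ((\bigcup_(A in S0) cond_set A) x); [left|right].
  by case=> [|[]]; [left|right].
rewrite measureU//; last 2 first.
- exact: mU.
- by apply/seteqP; split=> // x [Ux [_ /(_ Ux)]].
rewrite lteDl; last first.
  rewrite ge0_fin_numE//; apply: le_lt_trans mu_fin.
  by apply: le_measure; rewrite ?inE//; exact: mU.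
have := cond_gt0 Q.
by rewrite (measureDI mu mQ mC) [X in (X + _)%E]QC add0e.
Qed.

Definition meet_seq (s : seq cond) : set T := \big[setI/setT]_(A <- s) cond_set A.

Lemma meet_seqP (s : seq cond) (x : T) :
  meet_seq s x <-> forall A, A \in s -> cond_set A x.
Proof.
rewrite /meet_seq; elim: s => [|A s IH]; first by rewrite big_nil.
rewrite big_cons; split=> [[Ax /IH sx] B|sx].
  by rewrite inE => /predU1P[->//|/sx].
split; first by apply: sx; rewrite mem_head.
by apply/IH => B Bs; apply: sx; rewrite inE Bs orbT.
Qed.

Lemma measurable_meet_seq (s : seq cond) : measurable (meet_seq s).
Proof.
rewrite /meet_seq; elim: s => [|A s IH]; first by rewrite big_nil.
by rewrite big_cons; apply: measurableI => //; exact: cond_measurable.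
Qed.

(** Finite intersections of representatives with positive measure are again
    conditions, so they form a base of a filter. *)
Lemma filter_of_meets (K : set cond) :
  (forall s, (forall A, A \in s -> K A) -> (0 < mu (meet_seq s))%E) ->
  exists2 g : set forcing, forcing_filter g &
    forall A, K A -> g (\pi_(forcing) A).
Proof.
move=> Kpos.
pose g : set forcing := fun p => exists2 C : cond, (\pi_(forcing) C <= p)%O &
  exists2 s, forall A, A \in s -> K A & cond_set C = meet_seq s.
pose meet s Ks : cond := RandomCond (measurable_meet_seq s) (Kpos s Ks).
exists g; first split.
- have Knil A : A \in [::] -> K A by [].
  by exists (\pi_(forcing) (meet _ Knil)); exists (meet _ Knil) => //; exists [::].
- by move=> p q [C Cp Cs] pq; exists C => //; exact: le_trans Cp pq.
- move=> p q [C Cp [s Ks Cs]] [C' Cq [s' Ks' Cs']].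
  have Kcat A : A \in s ++ s' -> K A.
    by rewrite mem_cat => /orP[/Ks|/Ks'].
  exists (\pi_(forcing) (meet _ Kcat)); split.
  + by exists (meet _ Kcat) => //; exists (s ++ s').
  + apply: le_trans Cp; apply: pi_le_subset => x /meet_seqP sx.
    by rewrite Cs; apply/meet_seqP => A As; apply: sx; rewrite mem_cat As.
  + apply: le_trans Cq; apply: pi_le_subset => x /meet_seqP sx.
    by rewrite Cs'; apply/meet_seqP => A As; apply: sx; rewrite mem_cat As orbT.
- move=> A KA; have K1 B : B \in [:: A] -> K B by rewrite inE => /eqP ->.
  exists (meet _ K1); last by exists [:: A].
  by apply: pi_le_subset => x /meet_seqP; apply; rewrite mem_head.
Qed.

(** Two members of a filter have a common lower bound, which witnesses that
    the intersection of their representatives has positive measure; this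
    intersection is above the bound, hence in the filter. Used to bring
    representatives, and so points, back from the quotient. *)
Lemma filter_meet (g : set forcing) (A B : cond) : forcing_filter g ->
  g (\pi_(forcing) A) -> g (\pi_(forcing) B) ->
  exists2 C : cond, g (\pi_(forcing) C) & cond_set C = cond_set A `&` cond_set B.
Proof.
move=> [_ gup gmeet] gA gB; have [r] := gmeet _ _ gA gB.
elim/quotW: r => Q [gQ /random_leP QA /random_leP QB].
have [[mA mB] mQ] := (cond_measurable A, cond_measurable B, cond_measurable Q).
have mI : measurable (cond_set A `&` cond_set B) by exact: measurableI.
have QI : mu (cond_set Q `\` (cond_set A `&` cond_set B)) = 0%E.
  apply: measure_negligible; first exact: measurableD.
  rewrite setDIr; apply: negligibleU; apply/negligibleP => //;
    exact: measurableD.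
have I0 : (0 < mu (cond_set A `&` cond_set B))%E.
  apply: lt_le_trans (cond_gt0 Q) _.
  rewrite (measureDI mu mQ mI) [X in (X + _)%E]QI add0e.
  apply: le_measure; rewrite ?inE//.
  exact: measurableI.
by exists (RandomCond mI I0) => //; apply: gup gQ _; apply/random_leP.
Qed.

(** * From the non-covering statement to the forcing axiom *)

Context {dW : Order.disp_t} {W : orderType dW}.
Hypothesis segW : forall a : W, countable [set b : W | (b < a)%O].

Lemma countable_le (a : W) : countable [set b : W | (b <= a)%O].
Proof.
have -> : [set b : W | (b <= a)%O] = [set b | (b < a)%O] `|` [set a].
  apply/seteqP; split=> b /=; rewrite le_eqVlt; first by case/predU1P; [right|left].
  by case=> [->|->]; rewrite ?eqxx ?orbT.
exact: countable_setU1.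
Qed.

(** The null sets to avoid at stage [a] are the points missed by [S a] and the
    null finite intersections of conditions chosen up to stage [a]. Bounding
    the stage keeps each of these unions countable, and every finite family is
    bounded at some stage. *)
Lemma FA_of_not_null_union : (0 < mu setT)%E ->
  ~ (exists N : W -> set T,
      (forall a, mu.-negligible (N a)) /\ \bigcup_a N a = setT) ->
  FA forcing W.
Proof.
move=> muT nN D dD.
have /choice[S SP] a := dense_countable_cover (dD a).
pose S_le a := \bigcup_(b in [set b : W | (b <= a)%O]) S b.
have cS_le a : countable (S_le a).
  by apply: bigcup_countable; [exact: countable_le|move=> b _; case: (SP b)].
pose Z (a : W) := [set s : seq cond |
  (forall A, A \in s -> S_le a A) /\ mu (meet_seq s) = 0%E].
pose N a := ~` (\bigcup_(A in S a) cond_set A) `|` \bigcup_(s in Z a) meet_seq s.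
have nullN a : mu.-negligible (N a).
  apply: negligibleU; first by case: (SP a).
  apply: negligible_bigcup_countable.
    apply: sub_countable (countable_seq (cS_le a)).
    by apply: subset_card_le => s [].
  by move=> s [_ s0]; apply/negligibleP => //; exact: measurable_meet_seq.
have [x nx] : exists x, forall a, ~ N a x.
  apply: contrapT => /forallNP covN; apply: nN; exists N; split=> //.
  apply/seteqP; split=> // x _; have /existsNP[a /contrapT Nx] := covN x.
  by exists a.
pose K : set cond := fun A => (exists a, S a A) /\ cond_set A x.
have Ksup (s : seq cond) : (forall A, A \in s -> K A) -> s != [::] ->
    exists a, forall A, A \in s -> S_le a A.
  elim: s => // A s IH Ks _.
  have [[a Sa] _] := Ks A (mem_head _ _).
  have [->|s0] := eqVneq s [::].
    by exists a => B; rewrite inE => /eqP ->; exists a => /=.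
  have [|b sb] := IH _ s0; first by move=> B Bs; apply: Ks; rewrite inE Bs orbT.
  exists (Order.max a b) => B; rewrite inE => /predU1P[->|/sb[c /= cb Sc]].
    by exists a => //=; rewrite le_max lexx.
  by exists c => //=; rewrite le_max cb orbT.
have [|g gF gK] := @filter_of_meets K.
  (* A stage is read off a member of the family, so the empty family, whose
     intersection is the space, is treated apart. *)
  move=> s Ks; have [->|s0] := eqVneq s [::]; first by rewrite /meet_seq big_nil.
  have [a sa] := Ksup _ Ks s0.
  rewrite lt0e measure_ge0 andbT; apply/eqP => s_null.
  apply: (nx a); right; exists s => //.
  by apply/meet_seqP => A /Ks[].
exists g => // a.
have [A SA Ax] : (\bigcup_(A in S a) cond_set A) x.
  by apply: contrapT => nA; apply: (nx a); left.
exists (\pi_(forcing) A); split; first by apply: gK; split=> //; exists a.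
by case: (SP a) => _ + _; exact.
Qed.

End RandomForcingTheory.

(** * From the forcing axiom to the unbounded axiom *)

Section Unbounded.
Context {dP : Order.disp_t} {P : porderType dP}.
Context {dW : Order.disp_t} {W : orderType dW}.

Lemma is_omega1_unbounded (a : W) : is_omega1 W -> exists b : W, (a < b)%O.
Proof.
move=> [_ seg unc]; apply: contrapT => /forallNP a_max; apply: unc.
apply: sub_countable (countable_le seg a); apply: subset_card_le => b _ /=.
by rewrite leNgt; apply/negP; exact: a_max.
Qed.

Lemma FA_ubFA : is_omega1 W -> FA P W -> ubFA P W.
Proof.
move=> W1 fa D /fa[g gF gD]; exists g => // b.
by have [a ba] := is_omega1_unbounded b W1; exists a.
Qed.

End Unbounded.

(** * From the unbounded axiom to the non-covering statement *)

Section CompactSpace.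
Context {R : realType} {T : ptopologicalType}.
Local Notation borel := (g_sigma_algebraType (@open T)).
Variable mu : {measure set borel -> \bar R}.
Hypothesis mu_fin : (mu setT < +oo)%E.
Hypothesis compactT : compact [set: T].
Hypothesis open_Fsigma : forall U : set T, open U ->
  exists2 F : nat -> set T, forall n, closed (F n) & U = \bigcup_n F n.

(** The closed part of [B] minus [N] is taken with an error below the measure
    of that difference, so it cannot be null. *)
Lemma cond_closed_avoiding (B : random_cond mu) (N : set borel) :
  mu.-negligible N -> exists C : random_cond mu,
    [/\ closed (cond_set C : set T), cond_set C `<=` cond_set B & cond_set C `&` N = set0].
Proof.
move=> [Z [mZ Z0 NZ]].
have mB := cond_measurable B; have mBZ := measurableD mB mZ.
have BZ0 : (0 < mu (cond_set B `\` Z))%E.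
  apply: lt_le_trans (cond_gt0 B) _.
  rewrite (measureDI mu mB mZ) [X in (_ + X)%E]measure_negligible ?adde0//.
    exact: measurableI.
  by exists Z; split=> // x [].
have BZfin : mu (cond_set B `\` Z) \is a fin_num.
  rewrite ge0_fin_numE//; apply: le_lt_trans mu_fin.
  by apply: le_measure; rewrite ?inE.
have e0 : 0 < fine (mu (cond_set B `\` Z)).
  by rewrite fine_gt0// BZ0 -ge0_fin_numE.
have [F [G [cF cG FA GA FG]]] := closed_approx mu_fin open_Fsigma mBZ e0.
have mF : measurable (F : set borel) by exact: borel_closed.
have mG : measurable (G : set borel) by exact: borel_closed.
have F0 : (0 < mu (F : set borel))%E.
  rewrite lt0e measure_ge0 andbT; apply/eqP => F0.
  move: FG; rewrite fineK// ltNge => /negP; apply.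
  have mFG : measurable (~` (F `|` G) : set borel).
    by apply: measurableC; exact: measurableU.
  apply: (@le_trans _ _ (mu ((F : set borel) `|` ~` (F `|` G)))).
    apply: le_measure; rewrite ?inE//; first exact: measurableU.
    move=> x BZx; have [Fx|nF] := pselect (F x); first by left.
    by right=> -[//|/GA]; exact.
  apply: le_trans (measureU2 _ mF mFG) _.
  by rewrite [X in (X + _)%E]F0 add0e.
exists (RandomCond mF F0); split=> //=.
- by move=> x /FA[].
- by apply/seteqP; split=> // x [/FA[_ nZ] /NZ].
Qed.

(** The representatives of the members of [g] form a base of a proper filter
    of sets; a cluster point of it lies in all closed ones. A
    representative that is not closed may miss it, since its class only
    determines it up to a null set. *)
Lemma filter_closed_point (g : set (random_forcing mu)) : forcing_filter g ->
  exists x : T, forall C : random_cond mu,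
    closed (cond_set C : set T) -> g (\pi_(random_forcing mu) C) -> cond_set C x.
Proof.
move=> gF.
pose cond_in := [set C : random_cond mu | g (\pi_(random_forcing mu) C)].
pose F : set_system T := filter_from cond_in (fun C => cond_set C).
have FF : ProperFilter F.
  apply: filter_from_proper; last first.
    move=> C _; apply/set0P/eqP => C0; have := cond_gt0 C.
    by rewrite C0 measure0 ltxx.
  apply: filter_from_filter.
    by case: gF => -[p gp] _ _; elim/quotW: p gp => C gC; exists C.
  move=> A B gA gB; have [C gC CAB] := filter_meet gF gA gB.
  by exists C => // x; rewrite CAB.
have [x [_ Fx]] := compactT FF filterT.
exists x => C cC gC; move: Fx; rewrite clusterE => /(_ (cond_set C)).
by rewrite -((closure_id _).1 cC); apply; exists C.
Qed.

(** Unboundedly many dense sets suffice because the sets to avoid have been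
    made increasing: avoiding [N_le a] for some [a] above [b] avoids [N b]. *)
Lemma not_null_union_of_ubFA {dW : Order.disp_t} {W : orderType dW} :
  (forall a : W, countable [set b : W | (b < a)%O]) ->
  ubFA (random_forcing mu) W ->
  ~ exists N : W -> set borel,
      (forall a, mu.-negligible (N a)) /\ \bigcup_a N a = setT.
Proof.
move=> segW ub [N [N0 NT]].
pose N_le a := \bigcup_(b in [set b : W | (b <= a)%O]) N b.
pose D a : set (random_forcing mu) := fun p => exists C : random_cond mu,
  [/\ \pi_(random_forcing mu) C = p, closed (cond_set C : set T) &
      cond_set C `&` N_le a = set0].
have [|g gF gD] := ub D.
  move=> a; elim/quotW => B.
  have [|C [cC CB CN]] := @cond_closed_avoiding B (N_le a).
    by apply: negligible_bigcup_countable => //; exact: countable_le.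
  exists (\pi_(random_forcing mu) C); first by exists C.
  exact: pi_le_subset.
have [x gx] := filter_closed_point gF.
have [b _ Nbx] : (\bigcup_a N a) x by rewrite NT.
have [a ba [_ [/[swap] -[C [<- cC CN]] gC]]] := gD b.
have : (cond_set C `&` N_le a) x.
  by split; [exact: gx|exists b => //=; exact: ltW].
by rewrite CN.
Qed.

End CompactSpace.

(** * Cantor space *)

Lemma closed_cyl (t : seq bool) : closed (cyl t : set cantor_space).
Proof.
have -> : cyl t = \bigcap_(i in [set i | (i < size t)%N])
    (proj i @^-1` [set nth false t i]).
  apply/seteqP; split=> x /=.
    by move=> <- i /=; rewrite size_mkseq => it; rewrite nth_mkseq.
  move=> xt; apply: (@eq_from_nth _ false); rewrite size_mkseq// => i it.
  by rewrite nth_mkseq// -xt.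
apply: closed_bigI => i _; apply: preimage_closed; last exact: discrete_closed.
by move=> x _; exact: proj_continuous.
Qed.

Lemma cantor_open_Fsigma (U : set cantor_space) : open U ->
  exists2 F : nat -> set cantor_space,
    forall n, closed (F n) & U = \bigcup_n F n.
Proof.
move=> oU; have [->|/set0P U0] := eqVneq U set0.
  by exists (fun=> set0); [move=> _; exact: closed0|rewrite bigcup0].
have [||f fU Uf] := @countable_enum _ [set t | cyl t `<=` U].
- exact: countableP.
- have [x Ux] := U0; move: Ux; rewrite {1}(open_cantorE oU) => -[t tU _].
  by exists t.
exists (fun n => cyl (f n)); first by move=> n; exact: closed_cyl.
rewrite {1}(open_cantorE oU); apply/seteqP; split=> x.
  by move=> [t /Uf[n <-] tx]; exists n.
by move=> [n _ fx]; exists (f n).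
Qed.

Lemma cantor_lebesgueT (R : realType) (mu : {measure set borel_cantor -> \bar R}) :
  is_cantor_lebesgue mu -> mu setT = 1%E.
Proof.
move=> /(_ [::]); rewrite expr0 => <-; congr (mu _).
by apply/seteqP; split.
Qed.

Theorem proposition1p5 (R : realType)
    (mu : {measure set borel_cantor -> \bar R}) (hmu : is_cantor_lebesgue mu)
    (d : Order.disp_t) (omega1 : orderType d) (homega1 : is_omega1 omega1) :
  [<-> FA (random_forcing mu) omega1;
       ubFA (random_forcing mu) omega1;
       ~ exists N : omega1 -> set borel_cantor,
           (forall a, mu.-negligible (N a)) /\ \bigcup_a N a = setT].
Proof.
have mu1 := cantor_lebesgueT hmu.
have mu_fin : (mu setT < +oo)%E by rewrite mu1 ltry.
have [_ seg _] := homega1.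
tfae.
- exact: FA_ubFA.
- exact: (not_null_union_of_ubFA mu_fin cantor_space_compact cantor_open_Fsigma).
- by apply: FA_of_not_null_union => //; rewrite mu1.
Qed.
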